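(* Let $G$ be a $k$-tree, and let $\lambda=\{\lambda_1,\dots,\lambda_t\}$ be a partition of $k+1$ with parts of size at most $3$. Then $G$ is $\frac{1}{k+1}$-flexibly $\lambda$-choosable.
   Context: Graphs are finite and simple. For a nonnegative integer $k$, a $k$-tree is a graph that may be constructed by starting with a $k$-clique and then repeatedly adding a vertex of degree $k$ whose neighbors induce a $k$-clique; a $0$-tree is an independent set. A partition of $k+1$ is a multiset $\lambda=\{\lambda_1,\dots,\lambda_t\}$ of positive integers with $\lambda_1+\dots+\lambda_t=k+1$. A list assignment $L$ on $G$ assigns to each vertex $v$ a set $L(v)$ of colors. A $\lambda$-assignment on $G$ is a list assignment $L$ for which $\bigcup_{v\in V(G)}L(v)$ may be partitioned into parts $C_1,\dots,C_t$ such that $|L(v)\cap C_i|=\lambda_i$ for each $v\in V(G)$ and each $1\le i\le t$. An $L$-coloring is a proper coloring $\varphi$ of $G$ with $\varphi(v)\in L(v)$ for every $v$. A request on $G$ with list assignment $L$ is a function $r$ with $\operatorname{dom}(r)\subseteq V(G)$ and $r(v)\in L(v)$ for all $v\in\operatorname{dom}(r)$. For $\varepsilon>0$, $r$ is $\varepsilon$-satisfiable with respect to $L$ if there is an $L$-coloring $\varphi$ of $G$ such that $\varphi(v)=r(v)$ for at least $\varepsilon|\operatorname{dom}(r)|$ vertices $v\in\operatorname{dom}(r)$. $G$ is $\varepsilon$-flexibly $\lambda$-choosable if, for every $\lambda$-assignment $L$ and every request $r$ on $G$ with list assignment $L$, $r$ is $\varepsilon$-satisfiable with respect to $L$. *)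

(* Defs.v *)
From HB Require Import structures.
From mathcomp Require Import all_boot all_order all_algebra finmap.

Set Implicit Arguments.
Unset Strict Implicit.
Unset Printing Implicit Defensive.

Import Order.TTheory GRing.Theory Num.Theory.

Record sgraph := SGraph {
  vertex :> finType;
  adj : rel vertex;
  adj_sym : symmetric adj;
  adj_irrefl : irreflexive adj
}.

Definition clique (G : sgraph) (A : {set G}) : Prop :=
  forall u v : G, u \in A -> v \in A -> u != v -> adj u v.

(* [ktree_on k A]: the subgraph of [G] induced by [A] is a k-tree.  For k = 0
   this says that [A] is independent, the empty set included. *)
Inductive ktree_on (G : sgraph) (k : nat) : {set G} -> Prop :=
| ktree_base (A : {set G}) : #|A| = k -> clique A -> ktree_on k A
| ktree_step (A : {set G}) (v : G) :
    ktree_on k A -> v \notin A ->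
    #|[set u in A | adj v u]| = k -> clique [set u in A | adj v u] ->
    ktree_on k (v |: A).

Definition ktree (k : nat) (G : sgraph) : Prop := ktree_on k [set: G].

(* The multiset of parts is given by a list; the order of the list is
   irrelevant to the notions below. *)
Definition is_partition (n : nat) (lam : seq nat) : Prop :=
  all (fun m => 0 < m) lam /\ sumn lam = n.

Section ListAssignments.
Variables (G : sgraph) (C : choiceType).
Implicit Types (L : G -> {fset C}) (r : G -> option C) (phi : G -> C).

(* Nonemptiness of the parts need not be required: the entries of [lam] being
   positive, it follows from the last condition as soon as [G] has a vertex. *)
Definition lambda_assignment (lam : seq nat) L : Prop :=
  exists P : 'I_(size lam) -> {fset C},
    [/\ forall i j, i != j -> [disjoint P i & P j]%fset,
        (\bigcup_(i <- enum 'I_(size lam)) P i)%fset =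
          (\bigcup_(v <- enum G) L v)%fset
      & forall (v : G) (i : 'I_(size lam)),
          #|` (L v `&` P i)%fset | = nth 0 lam i].

Definition list_coloring L phi : Prop :=
  (forall v, phi v \in L v) /\ (forall u v, adj u v -> phi u != phi v).

(* A request is a partial function, with value [None] outside its domain. *)
Definition request L r : Prop := forall v c, r v = Some c -> c \in L v.

Definition rdom r : {set G} := [set v | r v != None].

Definition satisfiable (R : realFieldType) (eps : R) L r : Prop :=
  exists2 phi, list_coloring L phi &
    (eps * #|rdom r|%:R <= #|[set v in rdom r | r v == Some (phi v)]|%:R)%R.

End ListAssignments.

Definition flexibly_choosable (R : realFieldType) (eps : R) (lam : seq nat)
    (G : sgraph) : Prop :=
  forall (C : choiceType) (L : G -> {fset C}) (r : G -> option C),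
    lambda_assignment lam L -> request L r -> satisfiable eps L r.

(* Main.v *)
Require Import Defs.
From mathcomp Require Import all_boot all_order all_algebra finmap.

(* It suffices to find finitely many L-colorings such that, at every vertex v,
   each color of L(v) is used by a fraction 1/(k+1) of them; averaging then
   gives one that satisfies the request.  Fix a proper coloring [col] of G by
   Z/(k+1), distribute the k+1 elements ("slots") into groups of sizes
   lambda_i, and let a shift j in Z/(k+1) send v to the group of [col v + j];
   over all shifts, v is in group i exactly lambda_i times.  For fixed j the
   vertices of group i are colored from L(v) n C_i, and along the construction
   of the k-tree each of them has at most lambda_i - 1 earlier neighbors in its
   group, which form a clique.  So it remains to find, for lists of size
   m <= 3, six colorings using every color of every list 6/m times.

   For m = 3, view the six values at a vertex as a perfect matching of six
   points with edges labelled by colors.  The invariant is that adjacent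
   vertices have disjoint matchings, in which edges with a common label are
   disjoint: then the pairs of values are (a_i, b_j), i <> j, each once, for
   suitable enumerations a, b of the two lists.  A new vertex w adjacent to
   both ends u, v of an edge is colored by a third matching.  The list of w can
   be matched with that of u, and with that of v, by bijections respecting
   common colors, whose ratio is an involution x of Z/3; the third matching is
   then [comp3 x]. *)

Set Implicit Arguments.
Unset Strict Implicit.
Unset Printing Implicit Defensive.

Import Order.TTheory GRing.Theory Num.Theory.

(** * Permutations of Z/3 and the alignment of three-color lists *)

Section Triples.
Local Open Scope ring_scope.

(* [None] stands for the identity, [Some x] for the transposition of Z/3 fixing
   x. *)
Definition refl3 (x : option 'I_3) (i : 'I_3) : 'I_3 :=
  if x is Some x then - x - i else i.

(* For [x = None] this is the element different from i and j. *)
Definition comp3 (x : option 'I_3) (i j : 'I_3) : 'I_3 :=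
  if x == Some i then j else - i - j.

Lemma ord3_ind (P : 'I_3 -> Prop) : P 0 -> P 1 -> P (-1) -> forall i, P i.
Proof.
move=> P0 P1 P2 [[|[|[|//]]] lti].
- by rewrite (_ : Ordinal lti = 0) //; apply: val_inj.
- by rewrite (_ : Ordinal lti = 1) //; apply: val_inj.
- by rewrite (_ : Ordinal lti = -1) //; apply: val_inj.
Qed.

(** An explicit conjunction, so that [align_check] can be settled by evaluation. *)
Definition all_opt3 (b : option 'I_3 -> bool) :=
  [&& b None, b (Some 0), b (Some 1) & b (Some (-1))].

Lemma all_opt3P b : all_opt3 b -> forall x, b x.
Proof. by case/and4P=> ? ? ? ? [i|//]; elim/ord3_ind: i. Qed.

Lemma refl3K x : involutive (refl3 x).
Proof. by case: x => [x|] i //=; rewrite opprB addrCA subrr addr0. Qed.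

(** With the next three lemmas, this makes the third matching form off-diagonal pairs with both
    given ones. *)
Lemma comp3_neql x i j : i != j -> comp3 x i j != i.
Proof.
case: x => [x|]; last by elim/ord3_ind: i; elim/ord3_ind: j.
by elim/ord3_ind: x; elim/ord3_ind: i; elim/ord3_ind: j.
Qed.

Lemma refl3_comp3_neqr x i j : i != j -> refl3 x (comp3 x i j) != j.
Proof.
case: x => [x|]; last by elim/ord3_ind: i; elim/ord3_ind: j.
by elim/ord3_ind: x; elim/ord3_ind: i; elim/ord3_ind: j.
Qed.

Lemma comp3_injr x i : injective (comp3 x i).
Proof. by move=> j j'; rewrite /comp3; case: ifP => // _ /addrI/oppr_inj. Qed.

Lemma comp3_injl x i i' j :
  i != j -> i' != j -> comp3 x i j = comp3 x i' j -> i = i'.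
Proof.
case: x => [x|]; last by rewrite /comp3 /= => _ _ /addIr/oppr_inj.
by elim/ord3_ind: x; elim/ord3_ind: i; elim/ord3_ind: j => //; elim/ord3_ind: i'.
Qed.

(* The affine maps i |-> u * i + t with u = 1, -1 are all permutations of
   Z/3. *)
Definition aligned3 (p q : 'I_3 -> option 'I_3) (u t : 'I_3) x :=
  all (fun j => ((p (u * j + t) == None) || (p (u * j + t) == Some j)) &&
     ((q (u * refl3 x j + t) == None) || (q (u * refl3 x j + t) == Some j)))
     [:: 0; 1; -1].

Definition tab (x y z : option 'I_3) (i : 'I_3) :=
  if i == 0 then x else if i == 1 then y else z.

Definition inj3 (p : 'I_3 -> option 'I_3) :=
  all (fun ij : 'I_3 * 'I_3 => (p ij.1 == None) || (p ij.1 != p ij.2))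
    [:: (0, 1); (0, -1); (1, -1)].

Definition compat3 (p q : 'I_3 -> option 'I_3) :=
  all (fun i => [|| p i == None, q i == None | p i == q i]) [:: 0; 1; -1].

(** Exhaustive search over partial injections given by their three values. A non-injective first map
    is discarded before the second is enumerated. *)
Lemma align_check :
  all_opt3 (fun p0 => all_opt3 (fun p1 => all_opt3 (fun p2 =>
    if inj3 (tab p0 p1 p2) then
      all_opt3 (fun q0 => all_opt3 (fun q1 => all_opt3 (fun q2 =>
        if inj3 (tab q0 q1 q2) && compat3 (tab p0 p1 p2) (tab q0 q1 q2) then
          has (fun u => has (fun t =>
              has (aligned3 (tab p0 p1 p2) (tab q0 q1 q2) u t)
                [:: None; Some 0; Some 1; Some (-1)])
            [:: 0; 1; -1]) [:: 1; -1]
        else true)))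
    else true))).
Proof. by lazy. Qed.

(* Here p i (resp. q i) is the position, among the three colors of a first (resp.
   second) neighbor, of the i-th color of the new vertex.  The bijections that
   extend p and q can be chosen with a ratio other than a 3-cycle: if some p i
   and q i are both defined then the ratio has a fixed point, and otherwise p or
   q is undefined at two points, whose values may be swapped. *)
Lemma align3 (p q : 'I_3 -> option 'I_3) :
  (forall i j m, p i = Some m -> p j = Some m -> i = j) ->
  (forall i j m, q i = Some m -> q j = Some m -> i = j) ->
  (forall i m n, p i = Some m -> q i = Some n -> m = n) ->
  exists f x, [/\ injective f, forall i m, p (f i) = Some m -> m = i
    & forall i m, q (f (refl3 x i)) = Some m -> m = i].
Proof.
move=> p_inj q_inj pq.
have tabE (r : 'I_3 -> option 'I_3) : tab (r 0) (r 1) (r (-1)) =1 r by elim/ord3_ind.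
have tab_inj (r : 'I_3 -> option 'I_3) :
    (forall i j m, r i = Some m -> r j = Some m -> i = j) ->
    inj3 (tab (r 0) (r 1) (r (-1))).
  move=> r_inj; apply/allP=> -[i j] ij; rewrite !(tabE r) /=.
  case ri: (r i) => [m|] //=; apply/eqP=> rj.
  move: ij; rewrite (r_inj _ _ _ ri (esym rj)) !inE !xpair_eqE.
  by elim/ord3_ind: j {rj}.
have pqc : compat3 (tab (p 0) (p 1) (p (-1))) (tab (q 0) (q 1) (q (-1))).
  apply/allP=> i _; rewrite (tabE p) (tabE q).
  case pi: (p i) => [m|] //=; case qi: (q i) => [n|] //=.
  by rewrite (pq _ _ _ pi qi).
have := align_check.
move=> /all_opt3P/(_ (p 0)) /all_opt3P/(_ (p 1)) /all_opt3P/(_ (p (-1))).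
rewrite tab_inj //.
move=> /all_opt3P/(_ (q 0)) /all_opt3P/(_ (q 1)) /all_opt3P/(_ (q (-1))).
rewrite tab_inj // pqc => /hasP[u u_in /hasP[t _ /hasP[x _ /allP good]]].
have {}good i : ((p (u * i + t) == None) || (p (u * i + t) == Some i)) &&
     ((q (u * refl3 x i + t) == None) || (q (u * refl3 x i + t) == Some i)).
  have /good : i \in [:: 0; 1; -1] by elim/ord3_ind: i.
  by rewrite !(tabE p) !(tabE q).
exists (fun i => u * i + t), x; split=> [i j /addIr|i m pm|i m qm].
- by move: u_in; rewrite !inE => /orP[] /eqP->; rewrite ?mul1r ?mulN1r // => /oppr_inj.
- by case/andP: (good i) => + _; rewrite pm => /eqP[].
- by case/andP: (good i) => _; rewrite qm => /eqP[].
Qed.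

End Triples.

(** * Off-diagonal pairs and the third matching *)

(* [s |-> (x s, y s)] is a bijection onto the off-diagonal pairs. *)
Definition offdiag (x y : 'I_6 -> 'I_3) :=
  (forall s, x s != y s) /\ (forall s t, x s = x t -> y s = y t -> s = t).

Lemma offdiag_sym x y : offdiag x y -> offdiag y x.
Proof. by case=> xy inj; split=> [s|s t /[swap]]; [rewrite eq_sym | apply: inj]. Qed.

(** On a fibre of [x] the map [y] is injective and misses one value, so each of the three fibres has
    at most two elements; their sizes add up to 6. *)
Lemma offdiag_fibre x y i : offdiag x y -> #|[set s | x s == i]| = 2.
Proof.
case=> xy inj.
have le2 j : #|[set s | x s == j]| <= 2.
  have -> : #|[set s | x s == j]| = #|y @: [set s | x s == j]|.
    rewrite card_in_imset // => s t.
    by rewrite !inE => /eqP xs /eqP xt; apply: inj; rewrite xs xt.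
  apply: leq_trans (_ : _ <= #|~: [set j]|) _; last by rewrite cardsC1 card_ord.
  apply/subset_leq_card/subsetP=> _ /imsetP[s + ->].
  by rewrite !inE => /eqP <-; rewrite eq_sym.
have tot : \sum_j #|[set s | x s == j]| = \sum_(j < 3) 2.
  rewrite sum_nat_const card_ord -[RHS](card_ord 6) -sum1_card.
  rewrite (partition_big x predT) //=.
  by apply: eq_bigr => j _; rewrite -sum1_card; apply: eq_bigl => s; rewrite !inE.
have [_] := leqif_sum (P := predT) (fun j _ => leqif_eq (le2 j)).
by rewrite tot eqxx => /esym/forallP/(_ i)/eqP.
Qed.

Lemma offdiag_exists : exists x y, offdiag x y.
Proof.
(* Modulo 3, the second entry minus the first is 1 for [s < 3] and 2 afterwards. *)
exists (fun s => inord (s %% 3)), (fun s => inord ((s + s %/ 3 + 1) %% 3)).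
by split=> [[[|[|[|[|[|[|//]]]]]] ?]|[[|[|[|[|[|[|//]]]]]] ?] [[|[|[|[|[|[|//]]]]]] ?]];
  rewrite -?(inj_eq val_inj) /= ?inordK //;
  move=> /(congr1 val) + /(congr1 val); rewrite /= !inordK // => ? ?; apply/val_inj.
Qed.

Section Third.
Variable C : eqType.

Definition opt_inj (a : 'I_3 -> option C) :=
  forall i j c, a i = Some c -> a j = Some c -> i = j.

(* The enumerations a, b are partial so that the lemma also covers a vertex with
   fewer than two colored neighbors. *)
Lemma third_matching (a b : 'I_3 -> option C) (c : 'I_3 -> C) x y :
    opt_inj a -> opt_inj b -> injective c ->
    (forall i j d, a i = Some d -> b j = Some d -> i = j) ->
    offdiag x y ->
  exists c1 z c2 w,
    [/\ injective c1, injective c2, forall i, exists j, c1 i = c j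
       & forall s, c1 (z s) = c2 (w s)] /\
    [/\ offdiag x z, offdiag y w, forall i j, a i = Some (c1 j) -> i = j
       & forall i j, b i = Some (c2 j) -> i = j].
Proof.
move=> a_inj b_inj c_inj ab [xy xy_inj].
pose p (a : 'I_3 -> option C) j := [pick i | a i == Some (c j)].
have pP a' j i : p a' j = Some i -> a' i = Some (c j).
  by rewrite /p; case: pickP => // i' /eqP + [<-].
have pN a' j i : opt_inj a' -> a' i = Some (c j) -> p a' j = Some i.
  move=> a'_inj ai; rewrite /p; case: pickP => [i' /eqP ai'|/(_ i)].
    by rewrite (a'_inj _ _ _ ai ai').
  by rewrite ai eqxx.
have p_inj a' i j m : p a' i = Some m -> p a' j = Some m -> i = j.
  by move=> /pP ai /pP; rewrite ai => -[] /c_inj.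
have [|f [t [f_inj pf qf]]] := align3 (p_inj a) (p_inj b).
  by move=> i m n /pP ? /pP; apply: ab.
(* One coloring read in two enumerations of the list, the first aligned with [a], the second with
   [b]; they differ by the involution [refl3 t]. *)
exists (c \o f), (fun s => comp3 t (x s) (y s)).
exists (c \o f \o refl3 t), (fun s => refl3 t (comp3 t (x s) (y s))).
split; split.
- exact: inj_comp.
- by do 2?[apply: inj_comp => //]; apply/inv_inj/refl3K.
- by move=> i; exists (f i).
- by move=> s; rewrite /= refl3K.
- split=> [s|s s' xs]; first by rewrite eq_sym comp3_neql.
  by rewrite xs => /comp3_injr; apply: xy_inj.
- split=> [s|s s' ys]; first by rewrite eq_sym refl3_comp3_neqr.
  move=> /(inv_inj (refl3K t)); rewrite ys => xs; apply: xy_inj => //.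
  by apply: comp3_injl xs => //; rewrite -ys.
- by move=> i j /(pN _ _ _ a_inj)/pf.
- by move=> i j /(pN _ _ _ b_inj)/qf.
Qed.

End Third.

(** * Six-round colorings from lists of size at most 3 *)

Lemma fset_enum_inj (C : choiceType) (L : {fset C}) n :
  #|` L| = n.+1 -> exists c : 'I_n.+1 -> C, injective c /\ forall i, c i \in L.
Proof.
move=> cardL; have /fset0Pn[c0 _] : L != fset0 by rewrite -cardfs_gt0 cardL.
exists (fun i => nth c0 L i); split=> [i j /eqP|i].
  by rewrite nth_uniq ?cardL ?ltn_ord // => /eqP/val_inj.
by rewrite mem_nth // cardL.
Qed.

Lemma fset_enum_onto (C : choiceType) (L : {fset C}) n (a : 'I_n -> C) :
  #|` L| = n -> injective a -> (forall i, a i \in L) ->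
  forall c, c \in L -> exists i, c = a i.
Proof.
move=> cardL a_inj aL c cL.
have [|||_ /(_ c)] := @uniq_min_size _ (codom a) (enum_fset L).
- by rewrite map_inj_uniq ?enum_uniq.
- by move=> _ /codomP[i ->].
- by rewrite size_codom card_ord -cardL.
by rewrite cL => /codomP.
Qed.

Section Extension.
Variable C : choiceType.
Implicit Types (L : {fset C}) (f g h : 'I_6 -> C).

Definition balanced m L f :=
  exists (a : 'I_m -> C) (x : 'I_6 -> 'I_m),
    [/\ injective a, forall i, a i \in L, forall s, f s = a (x s)
      & forall i, m * #|[set s | x s == i]| = 6].

Lemma balanced_mem m L f s : balanced m L f -> f s \in L.
Proof. by case=> a [x [_ aL -> _]]. Qed.

Lemma balanced_count m L f c : #|` L| = m -> balanced m L f -> c \in L ->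
  m * #|[set s | f s == c]| = 6.
Proof.
move=> cardL [a [x [a_inj aL fE fib]]] /(fset_enum_onto cardL a_inj aL)[i ->].
apply: etrans (fib i); congr (_ * #|pred_of_set _|).
by apply/setP=> s; rewrite !inE fE (inj_eq a_inj).
Qed.

(** The step of adding a vertex with list [L], freed from the graph: [N] stands for its earlier
    neighbors in the same group, which form a clique. *)
Definition extendable m (E : ('I_6 -> C) -> ('I_6 -> C) -> Prop) :=
  forall (T : finType) (N : {set T}) (f : T -> 'I_6 -> C) (l : T -> {fset C}) L,
    #|N| < m -> #|` L| = m ->
    (forall u, u \in N -> balanced m (l u) (f u)) ->
    (forall u v, u \in N -> v \in N -> u != v -> E (f u) (f v)) ->
  exists h, balanced m L h /\ forall u, u \in N -> E (f u) h.

Definition compatibility m E :=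
  [/\ forall f g, E f g -> E g f, forall f g s, E f g -> f s != g s
    & extendable m E].

(** A group with a single slot contains no adjacent vertices, so the empty relation suffices. *)
Lemma compatibility1 : compatibility 1 (fun _ _ => False).
Proof.
split=> // T N f l L; rewrite ltnS leqn0 cards_eq0 => /eqP-> cardL _ _.
have [c [c_inj cL]] := fset_enum_inj cardL.
exists (fun=> c ord0); split=> [|u]; last by rewrite inE.
exists c, (fun=> ord0); split=> // i.
rewrite mul1n; transitivity #|[set: 'I_6]|; last by rewrite cardsT card_ord.
congr #|pred_of_set _|.
by apply/setP=> s; rewrite !inE !ord1.
Qed.

(** The new vertex copies the index map of its only neighbor. If the two enumerations agree at some
    position, reversing one of them removes every agreement. *)
Lemma compatibility2 : compatibility 2 (fun f g => forall s, f s != g s).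
Proof.
split=> [f g fg s|f g s //|T N f l L]; first by rewrite eq_sym.
rewrite ltnS leq_eqVlt ltnS leqn0 cards_eq0 => N01 cardL fB _.
have [c [c_inj cL]] := fset_enum_inj cardL.
case/orP: N01 => [/cards1P[u]|/eqP] defN; last first.
  exists (fun s => c (inord (s %/ 3))); split=> [|u]; last by rewrite defN inE.
  exists c, (fun s => inord (s %/ 3)); split=> // i.
  rewrite -sum1_card big_mkcond /= !big_ord_recl big_ord0 !inE.
  by case: i => [[|[|//]]] ?; rewrite -!(inj_eq val_inj) /= !inordK.
have [|a [x [a_inj _ fE fib]]] := fB u; first by rewrite defN set11.
have flip (p : 'I_2 -> 'I_2) : injective p ->
    (forall i, a i != c (p i)) ->
    exists h, balanced 2 L h /\ forall v, v \in N -> forall s, f v s != h s.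
  move=> p_inj ap; exists (fun s => c (p (x s))); split=> [|v].
    by exists (c \o p), x; split=> // [|i] /=; [apply: inj_comp | apply: cL].
  by rewrite defN inE => /eqP-> s; rewrite fE.
have [/existsP[i /eqP ai]|] := boolP [exists i, a i == c i]; last first.
  by rewrite negb_exists => /forallP; apply: (flip id).
apply: (flip (@rev_ord 2)); first exact: rev_ord_inj.
have neq_rev (j : 'I_2) : rev_ord j != j by case: j => [[|[|//]]].
have two (j : 'I_2) : j = i \/ j = rev_ord i.
  by case: i {ai} => [[|[|//]]] ?; case: j => [[|[|//]]] ?;
     [left | right | right | left]; apply: val_inj.
move=> j; case: (two j) => ->.
  by rewrite ai (inj_eq c_inj) eq_sym.
by rewrite rev_ordK -ai (inj_eq a_inj).
Qed.

Definition compatible3 f g :=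
  exists (a b : 'I_3 -> C) x y,
    [/\ injective a, injective b, forall i j, a i = b j -> i = j, offdiag x y
      & forall s, f s = a (x s) /\ g s = b (y s)].

(** The two elements of a fibre over [i] receive [i - 1] and [i + 1], in increasing order. *)
Lemma offdiag_complete (x : 'I_6 -> 'I_3) :
  (forall i, #|[set s | x s == i]| = 2) -> exists y, offdiag x y.
Proof.
move=> fib; pose later (s : 'I_6) := [exists t : 'I_6, (t < s) && (x t == x s)].
exists (fun s => (x s + (if later s then 1 else -1))%R).
have neq1 (i : 'I_3) (b : bool) : i != (i + (if b then 1 else -1))%R.
  by elim/ord3_ind: i; case: b.
split=> // s t xst /eqP; rewrite xst (inj_eq (addrI _)) => lst.
have {}lst : later s = later t by move: lst; case: (later s); case: (later t).
(* If [s1 < t1] then [t1] is later, hence so is [s1], and a third element of the fibre precedes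
   both. *)
suff lt (s1 t1 : 'I_6) : x s1 = x t1 -> later s1 = later t1 -> ~~ (s1 < t1).
  apply: val_inj; case: (ltngtP s t) (lt s t) (lt t s) => // _.
    by move=> /(_ xst lst).
  by move=> _ /(_ (esym xst) (esym lst)).
move=> {}xst {}lst; apply/negP=> st.
have: later s1 by rewrite lst; apply/existsP; exists s1; rewrite st xst /=.
case/existsP=> r /andP[rs /eqP xr].
have: 2 < #|[set s | x s == x t1]|.
  apply/card_gt2P; exists r, s1, t1; split; first by split; rewrite inE ?xr ?xst.
  by split; rewrite -(inj_eq val_inj) /= ?(ltn_eqF rs) ?(ltn_eqF st)
    ?(gtn_eqF (ltn_trans rs st)).
by rewrite fib.
Qed.

Lemma compatibility3 : compatibility 3 compatible3.
Proof.
have offdiag_balanced x y i : offdiag x y -> 3 * #|[set s | x s == i]| = 6.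
  by move=> /offdiag_fibre ->.
split=> [f g [a [b [x [y [a_inj b_inj ab xy fg]]]]]||].
- exists b, a, y, x; split=> // [i j /esym/ab //||s]; first exact: offdiag_sym.
  by case: (fg s).
- move=> f g s [a [b [x [y [_ _ ab [xy _] fg]]]]]; case: (fg s) => -> ->.
  by apply/eqP=> /ab /eqP; apply/negP.
move=> T N f l L ltN cardL fB fE.
have [c [c_inj cL]] := fset_enum_inj cardL.
pose none : 'I_3 -> option C := fun=> None.
pose some (a : 'I_3 -> C) i := Some (a i).
have none_inj : opt_inj none by [].
have some_inj a : injective a -> opt_inj (some a).
  by move=> a_inj i j d [<-] [/a_inj ->].
have cover c1 : (forall i, exists j, c1 i = c j) -> forall i, c1 i \in L.
  by move=> c1c i; have [j ->] := c1c i.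
have : [\/ N = set0, exists u, N = [set u] | exists u v, u != v /\ N = [set u; v]].
  case cardN: #|N| ltN => [|[|[|//]]] _; first by constructor 1; apply: cards0_eq.
    by constructor 2; move/eqP/cards1P: cardN.
  by constructor 3; move/eqP/cards2P: cardN => [u [v [uv ->]]]; exists u, v.
case=> [defN|[u defN]|[u [v [uv defN]]]].
- have [x [y xy]] := offdiag_exists.
  exists (c \o x); split=> [|u]; last by rewrite defN inE.
  by exists c, x; split=> // i; apply: offdiag_balanced xy.
- have [|a [x [a_inj _ fuE fib]]] := fB u; first by rewrite defN set11.
  (* The absent second neighbor gets the empty enumeration [none] and any index map completing
     [x]. *)
  have [|y xy] := @offdiag_complete x.
    by move=> i; apply/eqP; rewrite -(@eqn_pmul2l 3) // fib.
  have [|c1 [z [c2 [w [[c1_inj _ c1c _] [xz _ ac1 _]]]]]] :=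
    third_matching (some_inj _ a_inj) none_inj c_inj _ xy; first by [].
  exists (c1 \o z); split=> [|v].
    exists c1, z; split=> //; first exact: cover.
    by move=> i; apply: offdiag_balanced (offdiag_sym xz).
  rewrite defN inE => /eqP->; exists a, c1, x, z; split=> // i j aic.
  by apply: ac1; rewrite /some aic.
- have [|||a [b [x [y [a_inj b_inj ab xy fg]]]]] := fE u v.
  + by rewrite defN !inE eqxx.
  + by rewrite defN !inE eqxx orbT.
  + by [].
  have [|c1 [z [c2 [w [[c1_inj c2_inj c1c c12] [xz yw ac1 bc2]]]]]] :=
    third_matching (some_inj _ a_inj) (some_inj _ b_inj) c_inj _ xy.
    by move=> i j d [<-] [/esym/ab].
  exists (c1 \o z); split=> [|t].
    exists c1, z; split=> //; first exact: cover.
    by move=> i; apply: offdiag_balanced (offdiag_sym xz).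
  rewrite defN !inE => /orP[] /eqP->.
    exists a, c1, x, z; split=> // [i j aic|s]; last by case: (fg s).
    by apply: ac1; rewrite /some aic.
  exists b, c2, y, w; split=> // [i j bic|s].
    by apply: bc2; rewrite /some bic.
  by rewrite /= c12; case: (fg s).
Qed.

Lemma compatibility_exists m : 0 < m <= 3 -> exists E, compatibility m E.
Proof.
case: m => [|[|[|[|//]]]] // _.
- by exists (fun _ _ => False); apply: compatibility1.
- by exists (fun f g => forall s, f s != g s); apply: compatibility2.
- by exists compatible3; apply: compatibility3.
Qed.

End Extension.

(** * Building k-trees vertex by vertex *)

Section Graphs.
Variable G : sgraph.

(** Allowing smaller cliques lets the initial k-clique be built one vertex at a time too, so that
    inductions start from the empty set. *)
Inductive simplicial_build (k : nat) : {set G} -> Prop :=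
| build0 : simplicial_build k set0
| buildS (A : {set G}) (v : G) : simplicial_build k A -> v \notin A ->
    #|[set u in A | adj v u]| <= k -> clique [set u in A | adj v u] ->
    simplicial_build k (v |: A).

Lemma cliqueS (A B : {set G}) : A \subset B -> clique B -> clique A.
Proof. by move=> /subsetP sAB cB u v /sAB uB /sAB; apply: cB. Qed.

Lemma build_clique k (A : {set G}) : #|A| <= k -> clique A -> simplicial_build k A.
Proof.
have [n] := ubnP #|A|; elim: n A => // n IHn A ltAn leAk cA.
have [->|[v vA]] := set_0Vmem A; first exact: build0.
have sub : [set u in A :\ v | adj v u] \subset A.
  by apply/subsetP=> u; rewrite !inE => /andP[/andP[]].
rewrite -(setD1K vA); apply: buildS.
- have ltA : #|A :\ v| < #|A| by rewrite [X in _ < X](cardsD1 v) vA.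
  apply: IHn; first exact: leq_trans ltA _.
    exact: leq_trans (ltnW ltA) leAk.
  exact: cliqueS (subD1set A v) cA.
- by rewrite !inE eqxx.
- exact: leq_trans (subset_leq_card sub) leAk.
- exact: cliqueS sub cA.
Qed.

Lemma ktree_on_build k (A : {set G}) : ktree_on k A -> simplicial_build k A.
Proof.
elim=> [{}A cardA cA|{}A v _ IH vA deg cN]; first by apply: build_clique; rewrite ?cardA.
by apply: buildS => //; rewrite deg.
Qed.

Definition proper_on (D : eqType) (A : {set G}) (f : G -> D) :=
  forall u v, u \in A -> v \in A -> adj u v -> f u != f v.

Lemma build_coloring k (A : {set G}) :
  simplicial_build k A -> exists f : G -> 'I_k.+1, proper_on A f.
Proof.
elim=> [|{}A v _ [f fP] vA deg _]; first by exists (fun=> ord0) => u w; rewrite inE.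
set N := [set u in A | adj v u] in deg.
have /set0Pn[c] : ~: (f @: N) != set0.
  apply: contraTneq deg => fN; rewrite -ltnNge.
  apply: leq_trans (leq_imset_card f N).
  by rewrite -(setCK (f @: N)) fN setC0 cardsT card_ord.
rewrite inE => cN.
exists (fun u => if u == v then c else f u) => u w; rewrite !inE.
have fresh x : x \in A -> adj v x -> c != f x.
  by move=> xA vx; apply: contraNneq cN => ->; rewrite imset_f // inE xA.
case: eqVneq => [->|uv] /=; case: eqVneq => [->|wv] //=; rewrite ?adj_irrefl //.
- by move=> _; apply: fresh.
- by move=> uA _; rewrite adj_sym eq_sym; apply: fresh.
- exact: fP.
Qed.

Lemma balanced_family (D : finType) (C : choiceType) k (A : {set G})
    (col : G -> D) (K : {set D}) (L : G -> {fset C}) m E :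
  simplicial_build k A -> proper_on A col -> #|K| = m -> 0 < m ->
  (forall v, #|` L v| = m) -> compatibility m E ->
  exists psi : G -> 'I_6 -> C,
    (forall v, v \in A -> col v \in K -> balanced m (L v) (psi v)) /\
    (forall u v, u \in A -> v \in A -> col u \in K -> col v \in K -> adj u v ->
       E (psi u) (psi v)).
Proof.
move=> bA cP cardK m_gt0 cardL [Esym _ Eext].
elim: bA cP => [|{}A w _ IH wA _ cN] cP.
  (* Default colors are taken vertex by vertex, since [C] may be empty when [G] is. *)
  have L_neq0 v : exists c, c \in L v.
    by apply/fset0Pn; rewrite -cardfs_gt0 cardL.
  have [c0 _] := fin_all_exists L_neq0.
  by exists (fun v _ => c0 v); split=> [v|u v]; rewrite inE.
have [|psi [psiB psiE]] := IH.
  by move=> u v uA vA; apply: cP; rewrite inE ?uA ?vA orbT.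
have [wK|wK] := boolP (col w \in K); last first.
  exists psi; split=> [v|u v]; rewrite !inE.
    by case: eqVneq => [->|_]; [rewrite (negPf wK) | apply: psiB].
  by case: eqVneq => [->|_]; case: eqVneq => [->|_] //=;
    rewrite ?(negPf wK) //; apply: psiE.
pose N := [set u in A | adj w u && (col u \in K)].
have NP u : u \in N -> [/\ u \in A, adj w u & col u \in K].
  by rewrite inE => /and3P.
have Nadj u v : u \in N -> v \in N -> u != v -> adj u v.
  by move=> /NP[uA wu _] /NP[vA wv _]; apply: cN; rewrite inE ?uA ?vA.
(* The clique [N] has distinct values of [col] in [K], all different from [col w]. *)
have ltN : #|N| < m.
  have N_inj : {in N &, injective col}.
    move=> u v uN vN /eqP; apply: contraTeq => uv.
    have [uA _ _] := NP _ uN; have [vA _ _] := NP _ vN.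
    by apply: cP; rewrite ?inE ?uA ?vA ?orbT //; apply: Nadj.
  rewrite -cardK (cardsD1 (col w)) wK ltnS -(card_in_imset N_inj).
  apply/subset_leq_card/subsetP=> _ /imsetP[u /NP[uA wu uK] ->].
  rewrite !inE uK andbT eq_sym; apply: cP => //; rewrite !inE ?eqxx //.
  by rewrite uA orbT.
have [u uN|u v uN vN uv|h [hB hE]] := Eext _ N psi L (L w) ltN (cardL w).
- by have [uA _ uK] := NP _ uN; apply: psiB.
- have [uA _ uK] := NP _ uN; have [vA _ vK] := NP _ vN.
  by apply: psiE => //; apply: Nadj.
have hadj u : u \in A -> col u \in K -> adj w u -> E (psi u) h.
  by move=> uA uK wu; apply: hE; rewrite inE uA wu.
exists (fun u => if u == w then h else psi u); split=> [v|u v]; rewrite !inE.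
  by case: eqVneq => [->|_] // vA; apply: psiB.
case: eqVneq => [->|_] /=; case: eqVneq => [->|_] //=; rewrite ?adj_irrefl //.
- by move=> _ vA _ vK wv; apply/Esym/hadj.
- by move=> uA _ uK _; rewrite adj_sym; apply: hadj.
- exact: psiE.
Qed.

End Graphs.

(** * Shifts of the slots and averaging *)

Lemma slots_exist n (lam : seq nat) : sumn lam = n ->
  exists g : 'I_n -> 'I_(size lam), forall i, #|[set x | g x == i]| = nth 0 lam i.
Proof.
move=> <-.
pose S := {i : 'I_(size lam) & 'I_(nth 0 lam i)}.
have cardS : #|{: S}| = sumn lam.
  rewrite card_tagged !sumnE big_map big_enum /= (big_nth 0) big_mkord.
  by apply: eq_bigr => i _; rewrite card_ord.
pose e (x : 'I_(sumn lam)) : S := enum_val (cast_ord (esym cardS) x).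
have e_inj : injective e by apply: inj_comp enum_val_inj (@cast_ord_inj _ _ _).
(* Slots enumerate the disjoint union of the groups, and the tag names the group. *)
exists (fun x => tag (e x)) => i.
rewrite -(card_imset _ e_inj) -[RHS]card_ord -[RHS]cardsT.
pose t (y : 'I_(nth 0 lam i)) : S :=
  Tagged (fun i : 'I_(size lam) => 'I_(nth 0 lam i)) y.
have t_inj : injective t by move=> y z /eqP; rewrite eq_Tagged => /eqP.
rewrite -(card_imset _ t_inj); congr #|pred_of_set _|; apply/setP=> s.
have [e' _ eK] : bijective e by apply: inj_card_bij => //; rewrite card_ord cardS.
apply/imsetP/imsetP=> [[x + ->]|[y _ ->]].
  by rewrite inE; case: (e x) => j y /= /eqP ji; subst j; exists y.
by exists (e' (t y)); rewrite ?eK // inE eK.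
Qed.

Theorem theorem3p4 (R : realFieldType) (G : sgraph) (k : nat) (lam : seq nat)
    (hG : ktree k G) (hlam : is_partition k.+1 lam)
    (hle3 : all (fun m => m <= 3) lam) :
  flexibly_choosable ((k.+1%:R)^-1 : R)%R lam G.
Proof.
move=> C L r [P [P_disj P_cover P_card]] r_req.
case: hlam => lam_gt0 sum_lam.
have lamP (i : 'I_(size lam)) : 0 < nth 0 lam i <= 3.
  by rewrite (all_nthP 0 lam_gt0) ?(all_nthP 0 hle3).
have bG := ktree_on_build hG.
have [col colP] := build_coloring bG.
have [g gP] := slots_exist sum_lam.
pose K (ji : 'I_k.+1 * 'I_(size lam)) := [set x | g (x + ji.1)%R == ji.2].
have cardK ji : #|K ji| = nth 0 lam ji.2.
  rewrite -gP -[RHS](card_preimset _ (addIr ji.1)).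
  by congr #|pred_of_set _|; apply/setP=> x; rewrite !inE.
have : forall ji : 'I_k.+1 * 'I_(size lam), exists psi : G -> 'I_6 -> C,
    (forall v, col v \in K ji ->
       balanced (nth 0 lam ji.2) (L v `&` P ji.2)%fset (psi v)) /\
    (forall u v s, col u \in K ji -> col v \in K ji -> adj u v ->
       psi u s != psi v s).
  move=> ji; have [E Ecomp] := compatibility_exists C (lamP ji.2).
  case/andP: (lamP ji.2) => m_gt0 _.
  have [psi [psiB psiE]] :=
    balanced_family bG colP (cardK ji) m_gt0 (fun v => P_card v ji.2) Ecomp.
  exists psi; split=> [v|u v s uK vK uv]; first exact: psiB.
  by case: Ecomp => _ Eneq _; apply: Eneq; apply: psiE.
case/fin_all_exists=> psi psiP.
pose slot j v := g (col v + j)%R.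
pose phi (js : 'I_k.+1 * 'I_6) v := psi (js.1, slot js.1 v) v js.2.
have slotK j v : col v \in K (j, slot j v) by rewrite inE.
have phi_mem js v : phi js v \in (L v `&` P (slot js.1 v))%fset.
  exact: balanced_mem ((psiP _).1 v (slotK js.1 v)).
have phiP js : list_coloring L (phi js).
  split=> [v|u v uv]; first by have := phi_mem js v; rewrite inE => /andP[].
  (* Within a group [psi] is proper; different groups draw on disjoint parts [P]. *)
  have [eq_uv|neq_uv] := eqVneq (slot js.1 u) (slot js.1 v).
    rewrite /phi eq_uv; apply: (psiP _).2 => //.
    by rewrite -eq_uv; apply: slotK.
  apply: contraNneq (neq_uv) => phi_uv.
  have := phi_mem js u; have := phi_mem js v.
  rewrite phi_uv !inE => /andP[_ vP] /andP[_ uP].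
  apply/eqP; apply: contraTeq uP => /P_disj/fdisjointP_sym; exact.
(* If [c] lies in part [i], then [nth 0 lam i] shifts put [v] in group [i], and each uses [c] in
   [6 %/ nth 0 lam i] rounds. *)
have count v c : c \in L v -> #|[set js | phi js v == c]| = 6.
  move=> cL.
  have [i cP] : exists i, c \in P i.
    have: c \in (\bigcup_(i <- enum 'I_(size lam)) P i)%fset.
      by rewrite P_cover; apply/bigfcupP; exists v; rewrite ?mem_enum.
    by case/bigfcupP=> i _ ciP; exists i.
  have only_i js : phi js v = c -> slot js.1 v = i.
    move=> phic; have := phi_mem js v; rewrite phic inE => /andP[_ cPs].
    by apply: contraTeq cPs => /P_disj/fdisjointP_sym; apply.
  have n_fib j : slot j v = i -> nth 0 lam i * #|[set s | phi (j, s) v == c]| = 6.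
    move=> ji; rewrite /phi /= ji; apply: balanced_count (P_card v i) _ _.
      by apply: (psiP (j, i)).1; rewrite -ji slotK.
    by rewrite inE cL.
  have m_gt0 : 0 < nth 0 lam i by case/andP: (lamP i).
  pose J := [set j | slot j v == i].
  have cardJ : #|J| = nth 0 lam i.
    rewrite -gP -[RHS](card_preimset _ (addrI (col v))).
    by congr #|pred_of_set _|; apply/setP=> x; rewrite !inE.
  have -> : #|[set js | phi js v == c]| =
      \sum_(j in J) #|[set s | phi (j, s) v == c]|.
    rewrite -sum1_card.
    under [RHS]eq_bigr do rewrite -sum1_card.
    rewrite pair_big_dep /=; apply: eq_bigl => -[j s]; rewrite !inE /=.
    by case: (phi _ v =P c) => [/only_i/= ->|]; rewrite ?eqxx ?andbF.
  rewrite (eq_bigr (fun=> 6 %/ nth 0 lam i)) => [|j]; last first.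
    by rewrite inE => /eqP/n_fib n6; rewrite -[X in _ = X %/ _]n6 mulKn.
  have [j jJ] : exists j, j \in J by apply/set0Pn; rewrite -card_gt0 cardJ.
  rewrite sum_nat_const cardJ mulnC divnK //.
  by move: jJ; rewrite inE => /eqP/n_fib n6; rewrite -[X in _ %| X]n6 dvdn_mulr.
pose sat js := #|[set v in rdom r | r v == Some (phi js v)]|.
have total : \sum_js sat js = 6 * #|rdom r|.
  transitivity (\sum_(v in rdom r) 6); last by rewrite sum_nat_const mulnC.
  under eq_bigr => js _ do rewrite /sat -sum1_card.
  rewrite (exchange_big_dep (mem (rdom r))) /=; last first.
    by move=> ? v _; rewrite inE => /andP[].
  apply: eq_bigr => v vr; move: (vr); rewrite inE.
  case rv: (r v) => [c|] // _; apply: etrans (count v c (r_req _ _ rv)).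
  rewrite -sum1_card.
  by apply: eq_bigl => js; rewrite !inE rv /= (inj_eq Some_inj) eq_sym.
(* The best of the 6(k+1) colorings satisfies at least the average number of requests. *)
have [js _ js_max] := @arg_maxnP _ (ord0, ord0) predT sat isT.
exists (phi js) => //.
rewrite ler_pdivrMl ?ltr0n // -natrM ler_nat -(@leq_pmul2l 6) // -total.
apply: (@leq_trans (\sum_(i : 'I_k.+1 * 'I_6) sat js)).
  by apply: leq_sum => i _; apply: js_max.
by rewrite sum_nat_const card_prod !card_ord mulnA (mulnC 6).
Qed.
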